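(* Let $\alpha \in (0,1)$ and $\lambda \in \mathbb{R}$, and let $f : [0,\infty) \to \mathbb{R}$ be the function defined by $f(t) = E_{\alpha}(\lambda t^{\alpha})$. Then $f(t+s) = f(t)f(s)$ for all $t, s \in [0,\infty)$ if and only if $\lambda = 0$.
   Context: For $\alpha > 0$, the Mittag-Leffler function $E_\alpha$ is the entire function defined by $E_{\alpha}(z) = \sum_{n=0}^\infty \frac{z^n}{\Gamma(\alpha n + 1)}$ for $z \in \mathbb{C}$, where $\Gamma$ is the Gamma function; it takes real values at real arguments. *)

(* Defs.v *)
From mathcomp Require Import all_boot all_order all_algebra.
From mathcomp Require Import complex.
From mathcomp Require Import all_classical all_reals all_analysis.

Set Implicit Arguments.
Unset Strict Implicit.
Unset Printing Implicit Defensive.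

Import Order.TTheory GRing.Theory Num.Theory.
Import numFieldNormedType.Exports.
Local Open Scope classical_set_scope.
Local Open Scope ring_scope.
Local Open Scope complex_scope.

(* Euler's integral; it converges only for 0 < x, and the value of gammaR
   is meaningful only there. *)
Definition gammaR (R : realType) (x : R) : R :=
  \int[lebesgue_measure]_(t in `]0, +oo[) (t `^ (x - 1) * expR (- t)).

(* The terms are cast to R[i]^o so that the limit is taken for the topology
   of the modulus. *)
Definition mittag_leffler (R : realType) (alpha : R) (z : R[i]) : R[i] :=
  lim (series (fun n : nat =>
    (z ^+ n / (gammaR (alpha * n%:R + 1))%:C : R[i]^o)) @ \oo).

(* Main.v *)
Require Import Defs.
From mathcomp Require Import all_boot all_order all_algebra.
From mathcomp Require Import complex.
From mathcomp Require Import all_classical all_reals all_analysis.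
From mathcomp Require Import measurable_realfun ring lra.
Import Order.TTheory GRing.Theory Num.Theory.
Import numFieldNormedType.Exports.
Local Open Scope ring_scope.
Local Open Scope complex_scope.

(** For [lambda = 0] the function is constantly [E_alpha(0) = 1/Gamma(1) = 1],
which is multiplicative.

Conversely, the contradiction comes from the diagonal [f (t + t) = f t ^+ 2]
near [t = 0]. With [v = t `^ alpha] and [h v = f (v `^ alpha^-1) = E_alpha(lambda v)]
it reads [h (q * v) = h v ^+ 2] with [q = 2 `^ alpha]. Since
[h v = 1 + b v + O(v ^+ 2)] with [b = lambda / Gamma(alpha + 1)], comparing the
terms of first order gives [q * b = 2 * b]; but [q < 2] because [alpha < 1], so
[b = 0] ([first_order_term]), and [Gamma(alpha + 1)] being finite and positive,
[lambda = 0].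

The expansion ([mittag_leffler_first_order]) holds because the coefficients
[1/Gamma(alpha n + 1)] are bounded by [expR 2] ([normr_gammaRV_le]): near [0] a
geometric series dominates the Mittag-Leffler series and its remainder of order
two. *)

(** * Euler's integral on [1, +oo[ *)

Section GammaEstimates.
Context {R : realType}.
Local Notation mu := (@lebesgue_measure R).
Implicit Types x t : R.

Lemma integral_exponential_density (r : R) : 0 < r ->
  (\int[mu]_(t in `]0%R, +oo[) (r * expR (- r * t))%:E = 1)%E.
Proof.
move=> r0.
have mf (D : set R) : measurable_fun D (EFin \o (fun t => r * expR (- r * t))).
  apply/measurable_EFinP/measurable_funTS/measurable_funM => //.
  by apply: measurableT_comp => //; exact: measurable_funM.
rewrite integral_itv_obnd_cbnd// -(integral_exponential_pdf r0) integral_mkcond.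
apply: eq_integral => t _; rewrite /exponential_pdf /patch.
by case: ifP.
Qed.

Lemma measurable_gamma_integrand (x : R) (D : set R) :
  measurable_fun D (EFin \o (fun t => t `^ (x - 1) * expR (- t))).
Proof.
apply/measurable_EFinP/measurable_funTS/measurable_funM.
  exact: measurable_powR.
by apply: measurableT_comp => //; exact: measurable_funN.
Qed.

Lemma gamma_integrand_ge0 (x t : R) : (0 <= (t `^ (x - 1) * expR (- t))%:E)%E.
Proof. by rewrite lee_fin mulr_ge0 ?powR_ge0 ?expR_ge0. Qed.

(** On [[1, 2]] the integrand is at least [1 * expR (- 2)], and this interval has
measure 1; the bound is therefore uniform in the exponent. *)
Lemma gamma_integral_ge (x : R) : 1 <= x ->
  ((expR (- 2))%:E <=
   \int[mu]_(t in `]0%R, +oo[) (t `^ (x - 1) * expR (- t))%:E)%E.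
Proof.
move=> x1.
apply: (@le_trans _ _
    (\int[mu]_(t in `[1%R, 2%R]) (t `^ (x - 1) * expR (- t))%:E)%E); last first.
  apply: ge0_subset_integral => //.
  - exact: measurable_gamma_integrand.
  - by move=> t _; exact: gamma_integrand_ge0.
  - by move=> t /=; rewrite !in_itv/= andbT => /andP[t1 _]; exact: lt_le_trans t1.
have -> : (expR (- 2))%:E = (\int[mu]_(t in `[1%R, 2%R]) (expR (- 2 : R))%:E)%E.
  rewrite integral_cst//= lebesgue_measure_itv/= lte_fin ltr1n.
  by rewrite -EFinB (_ : 2 - 1 = 1 :> R) ?mule1//; lra.
apply: ge0_le_integral => //.
- exact: measurable_gamma_integrand.
- move=> t /=; rewrite in_itv/= => /andP[t1 t2].
  rewrite lee_fin -[leLHS]mul1r ler_pM// ?expR_ge0//.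
    by rewrite -[leLHS](powRr0 t) ler_powR// subr_ge0.
  by rewrite ler_expR lerN2.
Qed.

(** For an exponent [x - 1] in [[0, 1]], [t `^ (x - 1)] is at most [1 + t], hence
at most [2 * expR (t / 2)]: the integrand is dominated by 4 times the density of
the exponential law of rate 1/2. *)
Lemma gamma_integral_lty (x : R) : 1 <= x <= 2 ->
  (\int[mu]_(t in `]0%R, +oo[) (t `^ (x - 1) * expR (- t))%:E < +oo)%E.
Proof.
move=> /andP[x1 x2].
pose p t : R := 2^-1 * expR (- 2^-1 * t).
have mp (D : set R) : measurable_fun D (EFin \o p).
  apply/measurable_EFinP/measurable_funTS/measurable_funM => //.
  by apply: measurableT_comp => //; exact: measurable_funM.
have pint : (\int[mu]_(t in `]0%R, +oo[) (p t)%:E = 1)%E.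
  by apply: integral_exponential_density; rewrite invr_gt0.
apply: (@le_lt_trans _ _ (\int[mu]_(t in `]0%R, +oo[) (4%:E * (p t)%:E))%E).
  apply: ge0_le_integral => //.
  - by move=> t _; exact: gamma_integrand_ge0.
  - exact: measurable_gamma_integrand.
  - exact: (measurable_funeM 4%:E (mp _)).
  - move=> t /=; rewrite in_itv/= andbT => t0.
    rewrite -EFinM lee_fin /p mulrA (_ : 4 * 2^-1 = 2 :> R); last by lra.
    have -> : expR (- t) = expR (2^-1 * t) ^- 1 * expR (- 2^-1 * t) :> R.
      by rewrite -expRN -expRD; congr expR; lra.
    rewrite mulrA ler_wpM2r ?expR_ge0// ler_pdivrMr ?expR_gt0//.
    have h : t `^ (x - 1) <= 1 + t.
      have [t1|/ltW t1] := leP t 1.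
        apply: (@le_trans _ _ 1); last by lra.
        have := @ger_powR _ t _ _ _ (_ : 0 <= x - 1).
        by rewrite powRr0; apply; [rewrite t0|lra].
      apply: (@le_trans _ _ t); last by lra.
      by rewrite -[leRHS]powRr1 ?(ltW t0)// ler_powR//; lra.
    have := @expR_ge1Dx R (2^-1 * t); lra.
rewrite ge0_integralZl//.
- by rewrite pint mule1 ltry.
- exact: mp.
- by move=> t _; rewrite lee_fin mulr_ge0 ?expR_ge0 ?invr_ge0.
Qed.

Lemma gammaR1 : gammaR 1 = 1 :> R.
Proof.
rewrite /gammaR /Rintegral subrr.
under eq_integral do rewrite powRr0 -mulN1r.
by rewrite integral_exponential_density.
Qed.

Lemma gammaR_gt0 (x : R) : 1 <= x <= 2 -> 0 < gammaR x.
Proof.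
move=> /[dup] /andP[x1 _] x12; apply: fine_gt0; apply/andP; split.
  by apply: lt_le_trans (gamma_integral_ge _ x1); rewrite lte_fin expR_gt0.
exact: gamma_integral_lty.
Qed.

(** When Euler's integral is infinite its real value is 0 by convention, and so
is the inverse; otherwise [gamma_integral_ge] bounds the inverse by [expR 2]. *)
Lemma normr_gammaRV_le (x : R) : 1 <= x -> `|(gammaR x)^-1| <= expR 2.
Proof.
move=> /gamma_integral_ge; rewrite /gammaR /Rintegral.
case: (\int[mu]_(t in _) _)%E => [g| |]//=; last by rewrite invr0 normr0 expR_ge0.
rewrite lee_fin => g2; have g0 : 0 < g by apply: lt_le_trans g2; exact: expR_gt0.
by rewrite ger0_norm ?invr_ge0 ?(ltW g0)// -[expR 2]invrK -expRN lef_pV2 ?posrE ?expR_gt0.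
Qed.

End GammaEstimates.

(** * Power series with bounded coefficients *)

Section PowerSeries.
Context {R : realType}.
Implicit Types (c u : R^nat) (M x : R).
Local Open Scope classical_set_scope.

Lemma is_cvg_normed_geometric_dominated u M x :
  `|x| < 1 -> (forall n, `|u n| <= M * `|x| ^+ n) ->
  cvgn [normed series u].
Proof.
move=> x1 uM; apply: (@series_le_cvg _ _ (geometric M `|x|)) => //.
- by move=> n; exact: normr_ge0.
- by move=> n; exact: le_trans (normr_ge0 _) (uM n).
- by apply: is_cvg_geometric_series; rewrite normr_id.
Qed.

Lemma lim_series_dominated u M x :
  `|x| < 1 -> (forall n, `|u n| <= M * `|x| ^+ n) ->
  `|limn (series u)| <= M / (1 - `|x|).
Proof.
move=> x1 uM; have cu := is_cvg_normed_geometric_dominated _ _ _ x1 uM.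
apply: le_trans (@lim_series_norm _ R^o _ cu) _.
have xx1 : `|(`|x|)| < 1 by rewrite normr_id.
rewrite -(cvg_lim (@Rhausdorff R) (@cvg_geometric_series R M _ xx1)).
by apply: lim_series_le => //; exact: is_cvg_geometric_series.
Qed.

Lemma is_cvg_bounded_pseries c M x :
  (forall n, `|c n| <= M) -> `|x| < 1 -> cvgn (series (fun n => c n * x ^+ n)).
Proof.
move=> cM x1; apply: (@normed_cvg _ R^o).
apply: (is_cvg_normed_geometric_dominated _ M x) => // n.
by rewrite normrM normrX ler_wpM2r// exprn_ge0.
Qed.

(** The remainder is the series of the terms of index at least 2, dominated by
the geometric series of first term [M * x ^+ 2] and ratio [`|x|]; the factor 2
bounds [1 / (1 - `|x|)]. *)
Lemma bounded_pseries_remainder c M x :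
  (forall n, `|c n| <= M) -> `|x| <= 2^-1 ->
  `|limn (series (fun n => c n * x ^+ n)) - c 0%N - c 1%N * x| <= 2 * M * x ^+ 2.
Proof.
move=> cM x2; have x1 : `|x| < 1 by lra.
set u := fun n => c n * x ^+ n.
have cu : cvgn (series u) := is_cvg_bounded_pseries _ _ _ cM x1.
pose v := [sequence u (n + 2)%N]_n.
have -> : limn (series u) - c 0%N - c 1%N * x = limn (series v).
  apply/esym/cvg_lim => //.
  have -> : series v = (fun n => series u (n + 2)%N - c 0%N - c 1%N * x).
    apply/funext => n; rewrite /series/= addn2 !big_nat_recl// /v /=.
    rewrite /u expr0 expr1 mulr1 addrA addrAC.
    rewrite (_ : c 0%N + _ + _ - _ - _ = \sum_(0 <= i < n) u i.+2); last first.
      by rewrite /u; ring.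
    by apply: eq_bigr => i _; rewrite addn2.
  apply: cvgB; last exact: cvg_cst.
  apply: cvgB; last exact: cvg_cst.
  by rewrite (cvg_shiftn 2 (series u)).
apply: (@le_trans _ _ (M * x ^+ 2 / (1 - `|x|))).
  apply: lim_series_dominated => // n.
  have -> : M * x ^+ 2 * `|x| ^+ n = M * `|x| ^+ (n + 2).
    by rewrite exprD real_normK ?num_real//; ring.
  by rewrite normrM normrX ler_wpM2r// exprn_ge0.
have M0 : 0 <= M := le_trans (normr_ge0 _) (cM 0%N).
rewrite ler_pdivrMr; last lra.
have := mulr_ge0 M0 (sqr_ge0 x); nra.
Qed.

End PowerSeries.

(** * Expansion of the Mittag-Leffler function at 0 *)

Lemma cvg_real_complex (R : realType) (u : R^nat) (l : R) :
  (u @ \oo --> l -> (fun n => (u n)%:C : R[i]^o) @ \oo --> (l%:C : R[i]^o))%classic.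
Proof.
move=> /cvgrPdist_lt ul; apply/cvgrPdist_lt => e e0.
have /complex_realP[r er] : e \is Num.real by exact: gtr0_real.
move: e0; rewrite er ltcR => /ul; apply: filterS => n.
by rewrite -rmorphB normc_def /= expr0n/= addr0 sqrtr_sqr ltcR.
Qed.

Lemma mittag_leffler_realE (R : realType) (alpha x : R) :
  cvgn (series (fun n => (gammaR (alpha * n%:R + 1))^-1 * x ^+ n)) ->
  mittag_leffler alpha x%:C =
  (limn (series (fun n => (gammaR (alpha * n%:R + 1))^-1 * x ^+ n)))%:C.
Proof.
move=> cu; apply: (@cvg_lim R[i]^o); first exact: norm_hausdorff.
suff -> : series (fun n => x%:C ^+ n / (gammaR (alpha * n%:R + 1))%:C : R[i]^o)
    = (fun n => (series (fun n => (gammaR (alpha * n%:R + 1))^-1 * x ^+ n) n)%:C).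
  exact: cvg_real_complex.
apply/funext => n; rewrite /series/= rmorph_sum/=; apply: eq_bigr => k _.
by rewrite rmorphM fmorphV rmorphXn mulrC.
Qed.

Lemma mittag_leffler0 (R : realType) (alpha : R) : mittag_leffler alpha 0%:C = 1.
Proof.
set u := fun n => (gammaR (alpha * n%:R + 1))^-1 * (0 : R) ^+ n.
have u1 : (series u @ \oo --> (1 : R))%classic.
  rewrite -(cvg_shiftn 1); apply: cvg_near_cst; apply: nearW => n.
  rewrite /series/= addn1 big_nat_recl// big1 ?addr0.
    by rewrite /u mulr0 add0r gammaR1 invr1 mulr1.
  by move=> i _; rewrite /u expr0n mulr0.
rewrite mittag_leffler_realE; last by apply/cvg_ex; exists 1.
by rewrite (cvg_lim _ u1).
Qed.

Lemma mittag_leffler_first_order (R : realType) (alpha x y : R) :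
  0 < alpha -> `|x| <= 2^-1 -> y%:C = mittag_leffler alpha x%:C ->
  `|y - 1 - (gammaR (alpha + 1))^-1 * x| <= 2 * expR 2 * x ^+ 2.
Proof.
move=> alpha0 x2.
pose c n := (gammaR (alpha * n%:R + 1))^-1.
have cM n : `|c n| <= expR 2.
  by apply: normr_gammaRV_le; rewrite lerDr mulr_ge0// ltW.
have x1 : `|x| < 1 by lra.
rewrite mittag_leffler_realE; last exact: is_cvg_bounded_pseries cM x1.
move=> /complexI ->.
have := bounded_pseries_remainder _ _ _ cM x2.
by rewrite /c mulr0 add0r gammaR1 invr1 mulr1.
Qed.

(** * The functional equation *)

(** Write [h v = 1 + b v + r] with [`|r| <= K v ^+ 2]. Then [h (q v) = h v ^+ 2] says
that [(2 - q) b v] is a combination of the remainders at [v] and [q v] and of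
[(b v + r) ^+ 2], all of order [v ^+ 2]. Dividing by [v] bounds
[(2 - q) `|b|] by [L v] for every small [v > 0]. *)
Lemma first_order_term (R : realType) (h : R -> R) (q b K d : R) :
  0 < d -> 0 <= q -> q < 2 ->
  (forall v, 0 <= v <= d -> `|h v - 1 - b * v| <= K * v ^+ 2) ->
  (forall v, 0 <= v -> h (q * v) = h v ^+ 2) -> b = 0.
Proof.
move=> d0 q0 q2 hexp hq.
have K0 : 0 <= K.
  have := hexp d; rewrite lexx (ltW d0) => /(_ isT) /(le_trans (normr_ge0 _)).
  by rewrite pmulr_lge0 ?exprn_gt0.
pose L := K * q ^+ 2 + 2 * K + (`|b| + K) ^+ 2.
(* As [q < 2], the condition [2 * v <= d] puts both [v] and [q * v] in range. *)
have small v : 0 < v -> v <= 1 -> 2 * v <= d -> (2 - q) * `|b| <= L * v.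
  move=> v0 v1 vd.
  have := hexp v; have := hexp (q * v).
  rewrite hq ?(ltW v0)// => Hq H.
  have {}H : `|h v - 1 - b * v| <= K * v ^+ 2 by apply: H; apply/andP; split; lra.
  have {}Hq : `|h v ^+ 2 - 1 - b * (q * v)| <= K * (q * v) ^+ 2.
    by apply: Hq; apply/andP; split; nra.
  rewrite -(ler_pM2r v0).
  have -> : (2 - q) * `|b| * v = `|(2 - q) * b * v|.
    by rewrite !normrM (gtr0_norm v0) gtr0_norm// subr_gt0.
  set r := h v - 1 - b * v in H.
  have -> : (2 - q) * b * v
      = h v ^+ 2 - 1 - b * (q * v) - 2 * r - (b * v + r) ^+ 2.
    by rewrite /r; ring.
  have lin : `|b * v + r| <= (`|b| + K) * v.
    rewrite mulrDl (le_trans (ler_normD _ _))//.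
    rewrite normrM (gtr0_norm v0) lerD2l (le_trans H)// ler_wpM2l//.
    by rewrite expr2 ler_piMl// ltW.
  have sq : `|(b * v + r) ^+ 2| <= (`|b| + K) ^+ 2 * v ^+ 2.
    by rewrite -exprMn normrX lerXn2r// nnegrE ?(le_trans _ lin).
  have := ler_normB (h v ^+ 2 - 1 - b * (q * v) - 2 * r) ((b * v + r) ^+ 2).
  have := ler_normB (h v ^+ 2 - 1 - b * (q * v)) (2 * r).
  have -> : `|2 * r| = 2 * `|r| by rewrite normrM ger0_norm.
  have -> : L * v * v
    = K * (q * v) ^+ 2 + 2 * (K * v ^+ 2) + (`|b| + K) ^+ 2 * v ^+ 2.
    by rewrite /L; ring.
  lra.
apply/eqP; rewrite -normr_le0 leNgt; apply/negP => b0.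
have L0 : 0 <= L by rewrite /L !addr_ge0 ?mulr_ge0 ?exprn_ge0 ?addr_ge0.
have B0 : 0 < (2 - q) * `|b| by rewrite mulr_gt0// subr_gt0.
set B := (2 - q) * `|b| in small B0.
(* [L + 1] rather than [L], which may vanish; this [v] gives [L * v < B]. *)
pose v := Num.min (Num.min 1 (d / 2)) (B / (2 * (L + 1))).
have v0 : 0 < v.
  by rewrite /v !lt_min ltr01 !divr_gt0// mulr_gt0//; lra.
have v1 : v <= 1 by rewrite /v !ge_min lexx.
have vd : v <= d / 2 by rewrite /v !ge_min lexx orbT.
have : v <= B / (2 * (L + 1)) by rewrite /v !ge_min lexx orbT.
rewrite ler_pdivlMr; last lra.
have := small v v0 v1; nra.
Qed.

Theorem theorem4 (R : realType) (alpha lambda : R)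
    (halpha0 : 0 < alpha) (halpha1 : alpha < 1)
    (f : R -> R)
    (hf : forall t : R, 0 <= t ->
      (f t)%:C = mittag_leffler alpha (lambda * t `^ alpha)%:C) :
  (forall t s : R, 0 <= t -> 0 <= s -> f (t + s) = f t * f s) <->
  lambda = 0.
Proof.
split=> [fD|l0 t s t0 s0]; last first.
  have f1 r : 0 <= r -> f r = 1.
    by move=> r0; apply: complexI; rewrite hf// l0 mul0r mittag_leffler0.
  by rewrite !f1 ?addr_ge0// mulr1.
have G0 : 0 < gammaR (alpha + 1) by apply: gammaR_gt0; apply/andP; split; lra.
apply/eqP/negPn/negP => l0.
have L0 : 0 < `|lambda| by rewrite normr_gt0.
(* [v] is the variable [t `^ alpha], in which doubling [t] multiplies by
   [2 `^ alpha]. *)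
pose h v := f (v `^ alpha^-1).
have powK v : 0 <= v -> (v `^ alpha^-1) `^ alpha = v.
  by move=> v0; rewrite -powRrM mulVf ?gt_eqF// powRr1.
suff /eqP : (gammaR (alpha + 1))^-1 * lambda = 0.
  by rewrite mulf_eq0 invr_eq0 (gt_eqF G0) (negPf l0).
apply: (@first_order_term _ h (2 `^ alpha) _ (2 * expR 2 * lambda ^+ 2)
          (2^-1 / `|lambda|)).
- by rewrite divr_gt0.
- exact: powR_ge0.
- by rewrite -[ltRHS]powRr1// /powR pnatr_eq0/= ltr_expR ltr_pM2r// ln_gt0// ltr1n.
- move=> v /andP[v0]; rewrite ler_pdivlMr// => vd.
  rewrite -[_ * lambda * v]mulrA -[_ * _ ^+ 2 * _]mulrA -exprMn.
  apply: mittag_leffler_first_order halpha0 _ _.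
    by rewrite normrM (ger0_norm v0) mulrC.
  by rewrite /h hf ?powR_ge0 ?(powK _ v0).
- move=> v v0; rewrite /h powRM ?powR_ge0// -powRrM mulfV ?gt_eqF// powRr1//.
  by rewrite mulr_natl mulr2n fD ?powR_ge0// expr2.
Qed.
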